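(* Let $\Sigma^{\otimes_1^n}=\Sigma_1\times\cdots\times\Sigma_n$ and for each site $i$ let $(P_i^t)_t$ be the transition probabilities of a Markov process on the finite alphabet $\Sigma_i$, with time $t$ ranging over $\mathbb{R}^+$ or over $\mathbb{Z}^+$. Put $P^t(x,y)=\prod_{i=1}^nP_i^t(x[i],y[i])$ for sequences $x,y$, and $\phi(x,y)=-\log\sup_tP^t(x,y)$. Then for any three vertices $a,b,c$ of a labeled tree, with labels $x,y,z$ respectively, $$\phi(x,y)+\phi(y,z)\ge\phi(x,z).$$
   Context: The transition probabilities satisfy the Markov (Chapman–Kolmogorov) property $P_i^{t+t'}(a,c)=\sum_{b\in\Sigma_i}P_i^t(a,b)P_i^{t'}(b,c)$. The supremum over $t$ is taken over the time domain of the model. A labeled tree is a tree $T$ together with a labeling $\lambda$ of its vertices by sequences in $\Sigma^{\otimes_1^n}$. *)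

(* Defs.v *)
From HB Require Import structures.
From mathcomp Require Import all_boot all_order all_algebra.
From mathcomp Require Import all_classical all_reals all_analysis.

Set Implicit Arguments.
Unset Strict Implicit.
Unset Printing Implicit Defensive.

Import Order.TTheory GRing.Theory Num.Theory.

Local Open Scope classical_set_scope.
Local Open Scope ring_scope.

(* R^+ or Z^+; both conventions on whether 0 belongs to the domain are
   admitted. *)
Definition is_time_domain (R : realType) (T : set R) : Prop :=
  [\/ T = [set t | 0 <= t],
      T = [set t | 0 < t],
      T = [set k%:R | k in [set: nat]]
    | T = [set k%:R | k in [set k : nat | (0 < k)%N]] ].

(* Values at times outside T are unconstrained (and never used below). *)
Record markov_transition (R : realType) (T : set R) (S : finType)
    (P : R -> S -> S -> R) : Prop := MarkovTransition {
  markov_ge0 : forall t, T t -> forall a b, 0 <= P t a b ;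
  markov_sum1 : forall t, T t -> forall a, \sum_(b : S) P t a b = 1 ;
  markov_id : T 0 -> forall a b, P 0 a b = (a == b)%:R ;
  markov_chapman_kolmogorov : forall t t', T t -> T t' -> forall a c,
    P (t + t') a c = \sum_(b : S) P t a b * P t' b c }.

Definition sequences (n : nat) (Sigma : 'I_n -> finType) :=
  {dffun forall i : 'I_n, Sigma i}.

Definition seq_transition (R : realType) (n : nat) (Sigma : 'I_n -> finType)
    (P : forall i : 'I_n, R -> Sigma i -> Sigma i -> R)
    (t : R) (x y : sequences Sigma) : R :=
  \prod_(i < n) P i t (x i) (y i).

(* Extended-real valued: phi x y = +oo when y is unreachable from x, since
   lne 0 = -oo. *)
Definition phi (R : realType) (T : set R) (n : nat) (Sigma : 'I_n -> finType)
    (P : forall i : 'I_n, R -> Sigma i -> Sigma i -> R)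
    (x y : sequences Sigma) : \bar R :=
  (- lne (ereal_sup [set (seq_transition P t x y)%:E | t in T]))%E.

(* In a simple graph the ucycles of size at most 2 are degenerate: a lone
   vertex is excluded by irreflexivity, and [:: u; v] runs back and forth
   along one edge. *)
Record is_tree (V : finType) (e : rel V) : Prop := IsTree {
  tree_sym : symmetric e ;
  tree_irr : irreflexive e ;
  tree_nonempty : (0 < #|V|)%N ;
  tree_connected : forall u v : V, connect e u v ;
  tree_acyclic : forall p : seq V, ucycle e p -> (size p <= 2)%N }.

(* Main.v *)
(* The likelihood sup_t P^t is supermultiplicative: keeping the single term b = y
   of the Chapman-Kolmogorov sum at each site gives
   P^t(x,y) P^t'(y,z) <= P^(t+t')(x,z), because the time domain is closed under
   addition.  Since all likelihoods lie in [0, 1], the logarithm turns this into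
   the triangle inequality with no indeterminate infinite sum. *)
Require Import Defs.
From HB Require Import structures.
From mathcomp Require Import all_boot all_order all_algebra.
From mathcomp Require Import all_classical all_reals all_analysis.

Set Implicit Arguments.
Unset Strict Implicit.
Unset Printing Implicit Defensive.

Import Order.TTheory GRing.Theory Num.Theory.

Local Open Scope classical_set_scope.
Local Open Scope ring_scope.

Lemma time_domain_nonempty (R : realType) (T : set R) :
  is_time_domain T -> T !=set0.
Proof.
case=> ->; exists 1 => /=; [exact: ler01|exact: ltr01|by exists 1%N|by exists 1%N].
Qed.

Lemma time_domainD (R : realType) (T : set R) (s t : R) :
  is_time_domain T -> T s -> T t -> T (s + t).
Proof.
case=> -> /=; [exact: addr_ge0|exact: addr_gt0| |].
- by move=> [k _ <-] [l _ <-]; exists (k + l)%N; rewrite ?natrD.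
- move=> [k k0 <-] [l l0 <-]; exists (k + l)%N; rewrite ?natrD//=.
  by rewrite addn_gt0 k0.
Qed.

Section MarkovTransition.
Variables (R : realType) (T : set R) (S : finType) (P : R -> S -> S -> R).
Hypothesis hP : markov_transition T P.

Lemma markov_le1 t a b : T t -> P t a b <= 1.
Proof.
move=> Tt; rewrite -(markov_sum1 hP Tt a) (bigD1 b)//= lerDl.
by apply: sumr_ge0 => c _; exact: markov_ge0 hP _ Tt _ _.
Qed.

Lemma markov_superM s t a b c : T s -> T t ->
  P s a b * P t b c <= P (s + t) a c.
Proof.
move=> Ts Tt; rewrite (markov_chapman_kolmogorov hP Ts Tt) (bigD1 b)//= lerDl.
by apply: sumr_ge0 => d _; apply: mulr_ge0; apply: (markov_ge0 hP).
Qed.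

End MarkovTransition.

Lemma mule_ereal_sup_le (R : realType) (r : R) (A : set (\bar R)) (c : \bar R) :
  0 <= r -> (0 <= c)%E -> (forall a, A a -> r%:E * a <= c)%E ->
  (r%:E * ereal_sup A <= c)%E.
Proof.
rewrite le_eqVlt => /predU1P[<-|r0] c0 Ac; first by rewrite mul0e.
rewrite -lee_pdivlMl//; apply: ge_ereal_sup => a Aa.
by rewrite lee_pdivlMl//; exact: Ac.
Qed.

Lemma le_lneD (R : realType) (x y z : \bar R) :
  (0 <= x <= 1)%E -> (0 <= y <= 1)%E -> (0 <= z)%E -> (x * y <= z)%E ->
  (lne x + lne y <= lne z)%E.
Proof.
move=> /andP[x0 x1] /andP[y0 y1] z0 xyz.
have [->|xn0] := eqVneq x 0%E; first by rewrite (le0_lneNy (lexx _)) addNye leNye.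
have [->|yn0] := eqVneq y 0%E; first by rewrite (le0_lneNy (lexx _)) addeNy leNye.
rewrite -lneM ?in_itv/= ?leey ?andbT ?lt_def ?xn0 ?yn0//.
by rewrite lee_lne ?in_itv/= ?leey ?andbT// mule_ge0.
Qed.

Section Likelihood.
Variables (R : realType) (T : set R) (n : nat) (Sigma : 'I_n -> finType).
Variable P : forall i : 'I_n, R -> Sigma i -> Sigma i -> R.
Hypothesis hT : is_time_domain T.
Hypothesis hP : forall i : 'I_n, markov_transition T (@P i).
Implicit Types x y z : sequences Sigma.

Let likelihood x y := ereal_sup [set (seq_transition P t x y)%:E | t in T].

Lemma seq_transition_ge0 t x y : T t -> 0 <= seq_transition P t x y.
Proof. by move=> Tt; apply: prodr_ge0 => i _; apply: (markov_ge0 (hP i)). Qed.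

Lemma seq_transition_le1 t x y : T t -> seq_transition P t x y <= 1.
Proof.
move=> Tt; apply: Num.Theory.prodr_ile1 => i _.
by rewrite (markov_ge0 (hP i))//= (markov_le1 (hP i)).
Qed.

Lemma seq_transition_superM s t x y z : T s -> T t ->
  seq_transition P s x y * seq_transition P t y z
    <= seq_transition P (s + t) x z.
Proof.
move=> Ts Tt; rewrite /seq_transition -big_split/=.
apply: ler_prod => i _; rewrite (markov_superM (hP i))// andbT.
by apply: mulr_ge0; apply: (markov_ge0 (hP i)).
Qed.

Lemma likelihood_itv x y : (0 <= likelihood x y <= 1)%E.
Proof.
apply/andP; split.
  have [t Tt] := time_domain_nonempty hT.
  apply: (@le_trans _ _ (seq_transition P t x y)%:E).
    by rewrite lee_fin seq_transition_ge0.
  by apply: ereal_sup_ubound; exists t.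
by apply: ge_ereal_sup => _ [t Tt <-]; rewrite lee_fin seq_transition_le1.
Qed.

Lemma likelihood_superM x y z :
  (likelihood x y * likelihood y z <= likelihood x z)%E.
Proof.
have /andP[xz0 _] := likelihood_itv x z.
have /andP[xy0 xy1] := likelihood_itv x y.
have xy_fin : likelihood x y \is a fin_num.
  by rewrite ge0_fin_numE// (le_lt_trans xy1)// ltry.
rewrite -(fineK xy_fin); apply: mule_ereal_sup_le => //; first exact: fine_ge0.
move=> _ [t Tt <-]; rewrite fineK// muleC.
apply: mule_ereal_sup_le => //; first exact: seq_transition_ge0.
move=> _ [s Ts <-]; rewrite muleC -EFinM.
apply: (@le_trans _ _ (seq_transition P (s + t) x z)%:E).
  by rewrite lee_fin seq_transition_superM.
by apply: ereal_sup_ubound; exists (s + t) => //; exact: time_domainD.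
Qed.

Lemma phi_triangle x y z : (phi T P x z <= phi T P x y + phi T P y z)%E.
Proof.
have /andP[_ xy1] := likelihood_itv x y.
have /andP[_ yz1] := likelihood_itv y z.
have /andP[xz0 _] := likelihood_itv x z.
rewrite /phi -oppeD; last first.
  by apply: ltpinfty_adde_def; rewrite inE (@le_lt_trans _ _ 0%E) ?lne_le0 ?ltry.
rewrite leeN2; apply: le_lneD => //; try exact: likelihood_itv.
exact: likelihood_superM.
Qed.

End Likelihood.

Theorem theorem2 (R : realType) (T : set R) (hT : is_time_domain T)
    (n : nat) (Sigma : 'I_n -> finType)
    (P : forall i : 'I_n, R -> Sigma i -> Sigma i -> R)
    (hP : forall i : 'I_n, markov_transition T (P i))
    (V : finType) (e : rel V) (he : is_tree e)
    (lambda : V -> sequences Sigma)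
    (a b c : V) (x y z : sequences Sigma)
    (hx : lambda a = x) (hy : lambda b = y) (hz : lambda c = z) :
  (phi T P x y + phi T P y z >= phi T P x z)%E.
Proof. exact: phi_triangle. Qed.
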